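(* Let $T:\mathbb{B}\to\underline{\mathbb{B}}$ be a one-to-one, continuous, linear map from a separable Banach space $\mathbb{B}$ into a Banach space $\underline{\mathbb{B}}$, and let $W$ be a Borel measurable, zero-mean Gaussian random element in $\mathbb{B}$ with RKHS $\mathbb{H}$. Then the RKHS $\underline{\mathbb{H}}$ of the Gaussian random element $TW$ in $\underline{\mathbb{B}}$ is equal to $T\mathbb{H}$, and $T:\mathbb{H}\to\underline{\mathbb{H}}$ is an isometry for the RKHS-norms.
   Context: All vector spaces are real. A Borel measurable random element $W$ in a separable Banach space $(\mathbb{B},\|\cdot\|)$ is zero-mean Gaussian if $b^*(W)$ is a (possibly degenerate) normal variable with mean zero for every $b^*\in\mathbb{B}^*$; then $\mathrm{E}\|W\|^2<\infty$. For $b^*\in\mathbb{B}^*$ let $Sb^*\in\mathbb{B}$ be the Pettis integral $\mathrm{E}Wb^*(W)$, i.e. the unique element with $b_2^*(Sb^* )=\mathrm{E}b_2^*(W)b^*(W)$ for every $b_2^*\in\mathbb{B}^*$. The RKHS $\mathbb{H}$ of $W$ is the completion of $S\mathbb{B}^*$ under the inner product $\langle Sb_1^*,Sb_2^*\rangle_{\mathbb{H}}=\mathrm{E}b_1^*(W)b_2^*(W)$. Because $\|Sb^*\|\le\sigma(W)\|Sb^*\|_{\mathbb{H}}$ with $\sigma^2(W)=\sup_{\|b^*\|=1}\mathrm{E}b^*(W)^2<\infty$, this completion is identified with a subset of $\mathbb{B}$ (an $\mathbb{H}$-Cauchy sequence in $S\mathbb{B}^*$ is identified with its limit in $\mathbb{B}$).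 The RKHS $\underline{\mathbb{H}}\subset\underline{\mathbb{B}}$ of $TW$ is defined in the same way, as the completion of the set of Pettis integrals $\underline{S}\,\underline{b}^*=\mathrm{E}(TW)\underline{b}^*(TW)$, $\underline{b}^*\in\underline{\mathbb{B}}^*$, under $\langle\underline{S}\,\underline{b}_1^*,\underline{S}\,\underline{b}_2^*\rangle_{\underline{\mathbb{H}}}=\mathrm{E}\underline{b}_1^*(TW)\underline{b}_2^*(TW)$. *)

(* Defs.v *)
From HB Require Import structures.
From mathcomp Require Import all_boot all_order all_algebra.
From mathcomp Require Import all_classical all_reals all_analysis.

Set Implicit Arguments.
Unset Strict Implicit.
Unset Printing Implicit Defensive.

Import Order.TTheory GRing.Theory Num.Theory.
Import numFieldNormedType.Exports.

Local Open Scope classical_set_scope.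
Local Open Scope ring_scope.

Definition separable (X : topologicalType) : Prop :=
  exists2 D : set X, countable D & dense D.

Definition dual (R : realType) (B : normedModType R) :
    set {linear B -> R^o} :=
  [set b | continuous b].
Arguments dual {R} B.

Definition borel_measurable (d : measure_display) (Omega : measurableType d)
    (R : realType) (B : normedModType R) (W : Omega -> B) : Prop :=
  measurable_fun [set: Omega] (W : Omega -> g_sigma_algebraType (@open B)).

(* The degenerate case is separate because [normal_prob 0 0] is not the Dirac
   mass at 0 but, by convention, the uniform law on [0, 1]. *)
Definition centered_normal (d : measure_display) (Omega : measurableType d)
    (R : realType) (P : probability Omega R) (X : Omega -> R) : Prop :=
  (forall A : set R, measurable A -> pushforward P X A = \d_(0 : R) A) \/
  (exists2 s : R, 0 < s &
    forall A : set R, measurable A -> pushforward P X A = normal_prob 0 s A).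

Definition zero_mean_gaussian (d : measure_display) (Omega : measurableType d)
    (R : realType) (P : probability Omega R) (B : normedModType R)
    (W : Omega -> B) : Prop :=
  borel_measurable W /\ forall b, dual B b -> centered_normal P (b \o W).

Section rkhs.
Context (d : measure_display) (Omega : measurableType d) (R : realType).
Context (P : probability Omega R) (B : completeNormedModType R).
Variable W : Omega -> B.

Implicit Types (b : {linear B -> R^o}) (h x : B).

(* [S b], the Pettis integral of [W * b(W)]. [get] returns an arbitrary point
   when nothing satisfies the predicate; exactly one element does for a zero-mean
   Gaussian [W] in a separable space, and for its image under a continuous linear
   map into any Banach space. *)
Definition pettis b : B :=
  get [set x | forall b2, dual B b2 ->
    (b2 x)%:E = 'E_P[fun w => (b2 (W w) * b (W w))%R]%E].

Definition pettis_range : set B := pettis @` dual B.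

(* The value E b1(W)b2(W) = b2(S b1) = b1(S b2) depends only on [h1 = S b1] and
   [h2 = S b2], so that [get] picks the only candidate. *)
Definition pettis_inner h1 h2 : R :=
  get [set r | exists b1 b2, [/\ dual B b1, dual B b2,
    pettis b1 = h1, pettis b2 = h2 &
    r%:E = 'E_P[fun w => (b1 (W w) * b2 (W w))%R]%E]].

Definition pettis_norm h : R := Num.sqrt (pettis_inner h h).

(* [hs] represents an element of the completion, identified with its limit [x] *)
Definition rkhs_approx (hs : nat -> B) x : Prop :=
  [/\ forall n, pettis_range (hs n),
      forall e : R, 0 < e -> exists N : nat, forall m n : nat,
        (N <= m)%N -> (N <= n)%N -> pettis_norm (hs m - hs n) < e &
      hs n @[n --> \oo] --> x].

Definition rkhs : set B := [set x | exists hs, rkhs_approx hs x].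

(* Norm of the completion: the limit of the norms along a representing
   sequence, which does not depend on the sequence. *)
Definition rkhs_norm x : R :=
  get [set r : R | exists2 hs, rkhs_approx hs x &
    pettis_norm (hs n) @[n --> \oo] --> r].

End rkhs.

Arguments pettis {d Omega R} P {B} W b.
Arguments pettis_range {d Omega R} P {B} W.
Arguments pettis_inner {d Omega R} P {B} W h1 h2.
Arguments pettis_norm {d Omega R} P {B} W h.
Arguments rkhs_approx {d Omega R} P {B} W hs x.
Arguments rkhs {d Omega R} P {B} W.
Arguments rkhs_norm {d Omega R} P {B} W x.

(* Main.v *)
(** The Pettis integral of [TW] against [b'] is the image under [T] of the Pettis
    integral of [W] against [b' o T], and both have the same RKHS-norm: hence the
    range for [TW] is the image of the functionals [b' o T] alone, and the point
    is that these are dense in all of [B^*] for the covariance seminorm.  Take a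
    minimizing sequence [c_n = b - b'_n o T] of the variance of [c_n(W)].  It is
    Cauchy by the parallelogram identity, so its Pettis integrals converge to
    some [g]; near-optimality makes [c_n(W)] asymptotically orthogonal to every
    [b'(TW)], which gives [b'(T g) = 0] for all [b'], hence [g = 0] as [T] is
    injective.  Then [c_n(W)] tends weakly to [0], and the Cauchy property turns
    this into convergence of the variances to [0].

    Existence of the Pettis integral of [W b(W)]: integrate [b(W)] against simple
    functions that round [W] to finitely many points of a dense sequence.  The
    error is uniform over the unit ball of [B^*] because the variances of [c(W)],
    [||c|| <= 1], are bounded: if [||W|| <= M] has probability at least [1/2], a
    centered normal variable that lies in [[-M, M]] with probability at least
    [1/2] has standard deviation at most [4 M]. *)

Require Import Defs.
From HB Require Import structures.
From mathcomp Require Import all_boot all_order all_algebra.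
From mathcomp Require Import all_classical all_reals all_analysis.
From mathcomp Require Import measurable_realfun ring lra.

Set Implicit Arguments.
Unset Strict Implicit.
Unset Printing Implicit Defensive.

Import Order.TTheory GRing.Theory Num.Theory.
Import numFieldNormedType.Exports.

Local Open Scope classical_set_scope.
Local Open Scope ring_scope.

(** * The Hahn-Banach theorem *)

Section hahn_banach.
Context (R : realType) (V : normedModType R).
Implicit Types (p q : V -> R) (x y : V).

(** Homogeneity is asked as an inequality because this form passes to infima; equality follows by
    rescaling with [t^-1]. *)
Definition sublinear p : Prop :=
  (forall x y, p (x + y) <= p x + p y) /\
  (forall t x, 0 <= t -> p (t *: x) <= t * p x).

Lemma sublinear0 p : sublinear p -> p 0 = 0.
Proof.
move=> [pD pZ]; apply/eqP; rewrite eq_le; apply/andP; split.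
  by have := pZ 0 0 (lexx _); rewrite scale0r mul0r.
by have := pD 0 0; rewrite addr0 -subr_ge0 addrK.
Qed.

Lemma sublinearZ p t x : sublinear p -> 0 <= t -> p (t *: x) = t * p x.
Proof.
move=> sp; rewrite le_eqVlt => /predU1P[<-|t0].
  by rewrite scale0r mul0r sublinear0.
apply/eqP; rewrite eq_le (sp.2 _ _ (ltW t0)) /= -ler_pdivlMl//.
by rewrite -{1}(scalerK (lt0r_neq0 t0) x) sp.2// invr_ge0 ltW.
Qed.

Lemma sublinear_ge p x : sublinear p -> - p (- x) <= p x.
Proof.
by move=> sp; rewrite -subr_ge0 opprK -(sublinear0 sp) -(subrr x) sp.1.
Qed.

Lemma norm_sublinear : sublinear (fun x => `|x|).
Proof.
by split=> [x y|t x t0]; rewrite ?ler_normD// normrZ ger0_norm.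
Qed.

(* The largest sublinear functional below [p] that takes the value [- p y] at
   [- y]: a minimal [p] must coincide with it, hence be additive. *)
Definition sublinear_shift p y x : R :=
  inf [set p (x + t *: y) - t * p y | t in [set t | 0 <= t]].

Section shift.
Context (p : V -> R) (y : V) (sp : sublinear p).
Let S x := [set p (x + t *: y) - t * p y | t in [set t | 0 <= t]].

(** Subadditivity at [t *: y = (x + t *: y) + (- x)] keeps the infimum finite. *)
Let lbS x : lbound (S x) (- p (- x)).
Proof.
move=> _ [t t0 <-]; rewrite lerBrDr -(sublinearZ _ sp t0) addrC lerBlDr.
by apply: le_trans (sp.1 _ _); rewrite addrAC subrr add0r.
Qed.

Lemma sublinear_shift_le x t :
  0 <= t -> sublinear_shift p y x <= p (x + t *: y) - t * p y.
Proof. by move=> t0; apply: ge_inf; [exists (- p (- x)); exact: lbS|exists t]. Qed.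

Let le_shift x r : lbound (S x) r -> r <= sublinear_shift p y x.
Proof.
move=> rS; apply: lb_le_inf => //.
by exists (p (x + 0 *: y) - 0 * p y); exists 0 => //=.
Qed.

Lemma sublinear_shift_sublinear : sublinear (sublinear_shift p y).
Proof.
split=> [x z|t x].
  rewrite -lerBlDr; apply: le_shift => _ [t t0 <-].
  rewrite lerBlDr [leRHS]addrC -lerBlDr; apply: le_shift => _ [u u0 <-].
  (* The parameters [t] at [x] and [u] at [z] are matched by [t + u] at [x + z]. *)
  have := sublinear_shift_le (x + z) (addr_ge0 t0 u0).
  have := sp.1 (x + t *: y) (z + u *: y); rewrite addrACA -scalerDl; lra.
rewrite le_eqVlt => /predU1P[<-|t0].
  rewrite mul0r scale0r; apply: le_trans (sublinear_shift_le _ (lexx _)) _.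
  by rewrite scale0r mul0r addr0 subr0 sublinear0.
rewrite -ler_pdivrMl//; apply: le_shift => _ [u u0 <-].
rewrite ler_pdivrMl//.
apply: le_trans (sublinear_shift_le _ (mulr_ge0 (ltW t0) u0)) _.
by rewrite -scalerA -scalerDr (sublinearZ _ sp (ltW t0)) mulrBr mulrA.
Qed.

Lemma sublinear_shift_le_id x : sublinear_shift p y x <= p x.
Proof.
have := sublinear_shift_le x (lexx 0).
by rewrite scale0r addr0 mul0r subr0.
Qed.

End shift.

(** Zorn's lemma for the reversed pointwise order on the sublinear functionals below [p]. The
    pointwise infimum of a chain is finite, since each member is at least [- p (- x)] at [x], and it
    stays sublinear because the chain is total. *)
Lemma minimal_sublinear p : sublinear p -> exists2 q, sublinear q &
  (forall x, q x <= p x) /\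
  (forall r, sublinear r -> (forall x, r x <= q x) -> r = q).
Proof.
move=> sp; pose T := {q : V -> R | sublinear q /\ forall x, q x <= p x}.
pose le (a b : T) := `[< forall x, sval b x <= sval a x >].
have [||||[q [sq qp]] qmax] := @Zorn T le.
- by move=> a; apply/asboolP.
- move=> a b c /asboolP ab /asboolP bc; apply/asboolP => x.
  exact: le_trans (bc x) (ab x).
- move=> [a Pa] [b Pb] /asboolP /= ab /asboolP /= ba; apply: eq_exist.
  by apply/funext => x; apply/eqP; rewrite eq_le ab ba.
- move=> A Atot; have [[a0 Aa0]|A0] := pselect (exists a, A a); last first.
    (* The empty chain is bounded by [p] itself. *)
    have Pp : sublinear p /\ forall x, p x <= p x by [].
    by exists (exist _ p Pp) => s As; exfalso; apply: A0; exists s.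
  pose S x := [set sval a x | a in A].
  have lbS x : has_lbound (S x).
    exists (- p (- x)) => _ [[a [sa ap]] _ <-] /=.
    by apply: le_trans (sublinear_ge x sa); rewrite lerN2.
  have S0 x : S x !=set0 by exists (sval a0 x); exists a0.
  pose m x := inf (S x).
  have mle a x : A a -> m x <= sval a x.
    by move=> Aa; apply: ge_inf => //; exists a.
  have sm : sublinear m.
    split=> [x y|t x].
      rewrite -lerBlDr; apply: lb_le_inf => // _ [a Aa <-].
      rewrite lerBlDr [leRHS]addrC -lerBlDr; apply: lb_le_inf => // _ [b Ab <-].
      (* Of two members of the chain, the smaller one serves at both points. *)
      rewrite lerBlDr [leRHS]addrC; have [/asboolP ab|/asboolP ba] := Atot _ _ Aa Ab.
        apply: le_trans (mle _ _ Ab) _; apply: le_trans ((svalP b).1.1 _ _) _.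
        by rewrite lerD2r ab.
      apply: le_trans (mle _ _ Aa) _; apply: le_trans ((svalP a).1.1 _ _) _.
      by rewrite lerD2l ba.
    rewrite le_eqVlt => /predU1P[<-|t0].
      rewrite mul0r scale0r; apply: le_trans (mle _ _ Aa0) _.
      by rewrite sublinear0//; case: (svalP a0).
    rewrite -ler_pdivrMl//; apply: lb_le_inf => // _ [a Aa <-].
    rewrite ler_pdivrMl//; apply: le_trans (mle _ _ Aa) _.
    by apply: (svalP a).1.2; exact: ltW.
  have mp x : m x <= p x by exact: le_trans (mle _ _ Aa0) ((svalP a0).2 _).
  by exists (exist _ m (conj sm mp)) => a Aa; apply/asboolP => x; exact: mle.
exists q => //; split => // r sr rq.
have rp x : r x <= p x by exact: le_trans (rq x) (qp x).
by have /(_ _)/(congr1 sval)/= <- := qmax (exist _ r (conj sr rp)); [|exact/asboolP].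
Qed.

(** A minimal [q] equals its own shift along every [y]; the parameter 1 in the infimum then gives
    the superadditivity [q x + q y <= q (x + y)]. *)
Lemma sublinear_dominates_linear p : sublinear p ->
  exists f : {linear V -> R^o}, forall x, f x <= p x.
Proof.
move=> /minimal_sublinear[q sq [qp qmin]].
have qD x y : q (x + y) = q x + q y.
  apply/eqP; rewrite eq_le sq.1 /=.
  have qE : sublinear_shift q y = q.
    apply: qmin; first exact: sublinear_shift_sublinear.
    exact: sublinear_shift_le_id.
  have := sublinear_shift_le y sq x ler01.
  by rewrite qE scale1r mul1r lerBrDr.
have qN x : q (- x) = - q x.
  by apply/eqP; rewrite -addr_eq0 -qD addrC subrr sublinear0.
have qlin : GRing.linear_for *:%R (q : V -> R^o).
  move=> t x y; rewrite qD; congr (_ + _).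
  have [t0|t0] := leP 0 t; first exact: sublinearZ.
  by rewrite -[t]opprK scaleNr qN (sublinearZ _ sq) ?oppr_ge0 ?ltW// -mulNr.
pose qL := GRing.isLinear.Build _ _ _ _ (q : V -> R^o) qlin.
pose f : {linear V -> R^o} := HB.pack (q : V -> R^o) qL.
by exists f.
Qed.

Lemma contraction_dual (f : {linear V -> R^o}) :
  (forall x, f x <= `|x|) -> dual V f.
Proof.
move=> fle; apply: bounded_linear_continuous; apply/linear_boundedP.
near=> r => x; apply: (@le_trans _ _ `|x|).
  by rewrite ler_norml fle lerNl -linearN (le_trans (fle _))// normrN.
by rewrite ler_peMl.
Unshelve. all: by end_near. Qed.

(** A linear functional below the norm shifted along [x] works: the shift at [- x] is at most
    [- |x|], by the parameter 1, which forces [f x] up to [|x|]. *)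
Lemma norming_functional x : exists2 f : {linear V -> R^o},
  dual V f & (forall y, `|f y| <= `|y|) /\ f x = `|x|.
Proof.
have sn := norm_sublinear.
have [f fle] := sublinear_dominates_linear (sublinear_shift_sublinear x sn).
have f1 y : f y <= `|y| by exact: le_trans (fle y) (sublinear_shift_le_id _ sn _).
exists f; first exact: contraction_dual.
split.
  by move=> y; rewrite ler_norml f1 lerNl -linearN (le_trans (f1 _))// normrN.
apply/eqP; rewrite eq_le f1 /= -lerN2 -linearN; apply: le_trans (fle _) _.
apply: le_trans (sublinear_shift_le x sn _ ler01) _.
by rewrite scale1r mul1r addNr normr0 sub0r.
Qed.

Lemma dual_separates x y : (forall f, dual V f -> f x = f y) -> x = y.
Proof.
move=> fxy; have [f df [_ fE]] := norming_functional (x - y).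
by apply/eqP; rewrite -subr_eq0 -normr_eq0 -fE linearB fxy ?subrr.
Qed.

End hahn_banach.

(** * Second moments of centered normal variables *)

Section normal_moment.
Context (R : realType).
Implicit Types (m s x : R).

(** The Radon-Nikodym derivative and [normal_pdf] have the same integral over every measurable set,
    so they agree almost everywhere, and the change of variables for the former carries over to the
    latter. *)
Lemma ge0_integral_normal_prob m s (f : R -> R) :
  measurable_fun setT f -> (forall x, 0 <= f x) ->
  (\int[normal_prob m s]_x (f x)%:E =
   \int[lebesgue_measure]_x ((f x)%:E * (normal_pdf m s x)%:E))%E.
Proof.
move=> /measurable_EFinP mf f0.
have f0' x : (0 <= (f x)%:E)%E by rewrite lee_fin.
have dom := normal_prob_dominates m s.
pose g := Radon_Nikodym_SigmaFinite.f (normal_prob m s) (@lebesgue_measure R).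
have gi : lebesgue_measure.-integrable setT g.
  exact: Radon_Nikodym_SigmaFinite.f_integrable.
have mpdf : measurable_fun setT (fun x => (normal_pdf m s x)%:E).
  by apply/measurable_EFinP; exact: measurable_normal_pdf.
rewrite -(Radon_Nikodym_SigmaFinite.change_of_variables dom f0' measurableT mf).
have : ae_eq lebesgue_measure setT g (fun x => (normal_pdf m s x)%:E).
  apply: integral_ae_eq => // E _ mE.
  by rewrite -(Radon_Nikodym_SigmaFinite.f_integral dom).
move=> gE; apply: ge0_ae_eq_integral => //.
- by apply: emeasurable_funM => //; exact: measurable_int gi.
- exact: emeasurable_funM.
- by move=> x _; rewrite mule_ge0// Radon_Nikodym_SigmaFinite.f_ge0.
- by move=> x _; rewrite mule_ge0// lee_fin normal_pdf_ge0.
- by apply: filterS gE => x /= h xT; rewrite -h.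
Qed.

Lemma normal_peak_double s : normal_peak s = 2 * normal_peak (2 * s).
Proof.
rewrite /normal_peak.
have -> : (2 * s) ^+ 2 * pi *+ 2 = 2 ^+ 2 * (s ^+ 2 * pi *+ 2) by ring.
rewrite sqrtrM ?sqr_ge0// sqrtr_sqr ger0_norm// invfM mulrA divff ?mul1r//.
Qed.

Lemma normal_peak_le s : 0 < s -> normal_peak s <= s^-1.
Proof.
move=> s0; rewrite /normal_peak lef_pV2 ?posrE ?sqrtr_gt0//; last first.
  by rewrite pmulrn_rgt0// mulr_gt0 ?exprn_gt0 ?pi_gt0.
rewrite -[leLHS](ger0_norm (ltW s0)) -sqrtr_sqr ler_wsqrtr//.
rewrite -mulrnAr ler_peMr ?sqr_ge0//.
have := pi_ge2 R; rewrite -mulr_natr; lra.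
Qed.

(* The factor [x ^+ 2] is absorbed by the exponential at the cost of doubling
   the standard deviation. *)
Lemma sqr_normal_pdf_le s x : 0 < s ->
  x ^+ 2 * normal_pdf 0 s x <= 6 * s ^+ 2 * normal_pdf 0 (2 * s) x.
Proof.
move=> s0; have s20 : 2 * s != 0 by rewrite lt0r_neq0 ?mulr_gt0.
rewrite /normal_pdf (negbTE s20) gt_eqF// (normal_peak_double s) /normal_fun !subr0.
set k := normal_peak _; have k0 : 0 <= k := normal_peak_ge0 _.
(* The difference of the exponents [x ^+ 2 / (2 s ^+ 2)] and [x ^+ 2 / (8 s ^+ 2)]. *)
pose u := 3 * x ^+ 2 / (8 * s ^+ 2).

have -> : - x ^+ 2 / (s ^+ 2 *+ 2) = - u + - x ^+ 2 / ((2 * s) ^+ 2 *+ 2).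
  by rewrite /u; field; rewrite lt0r_neq0.
rewrite expRD; set e := expR (_ / _); have e0 : 0 <= e := expR_ge0 _.
suff h : x ^+ 2 * expR (- u) <= 3 * s ^+ 2.
  have -> : x ^+ 2 * (2 * k * (expR (- u) * e)) =
    (x ^+ 2 * expR (- u)) * (2 * k * e) by ring.
  have -> : 6 * s ^+ 2 * (k * e) = 3 * s ^+ 2 * (2 * k * e) by ring.
  by apply: ler_wpM2r => //; rewrite !mulr_ge0.
rewrite expRN ler_pdivrMr ?expR_gt0//.
(* In [expR u >= 1 + u], the term [u] alone contributes [9 / 8 * x ^+ 2]. *)
apply: (@le_trans _ _ (3 * s ^+ 2 * (1 + u))).
  rewrite mulrDr mulr1.
  have -> : 3 * s ^+ 2 * u = 9 / 8 * x ^+ 2.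
    by rewrite /u; field; rewrite lt0r_neq0.
  have := sqr_ge0 x; have := sqr_ge0 s; lra.
by apply: ler_wpM2l; [rewrite mulr_ge0 ?sqr_ge0|exact: expR_ge1Dx].
Qed.

Lemma normal_second_moment_le s : 0 < s ->
  (\int[normal_prob 0 s]_x (x ^+ 2)%:E <= (6 * s ^+ 2)%:E)%E.
Proof.
move=> s0; have msqr : measurable_fun setT (fun x : R => (x ^+ 2)%:E).
  by apply/measurable_EFinP; exact: measurable_funX.
rewrite ge0_integral_normal_prob; first last.
- by move=> x; rewrite sqr_ge0.
- exact/measurable_EFinP.
rewrite -[leRHS]mule1 -(integral_normal_pdf 0 (2 * s)) -integralZl//; last first.
  exact: integrable_normal_pdf.
apply: ge0_le_integral => //.
- by move=> x _; rewrite mule_ge0// lee_fin ?sqr_ge0 ?normal_pdf_ge0.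
- by apply: emeasurable_funM => //; apply/measurable_EFinP; exact: measurable_normal_pdf.
- by apply: emeasurable_funM => //; apply/measurable_EFinP; exact: measurable_normal_pdf.
- by move=> x _; rewrite -!EFinM lee_fin sqr_normal_pdf_le.
Qed.

Lemma normal_prob_centered_itv_le s (M : R) : 0 < s -> 0 <= M ->
  (normal_prob 0 s `[(- M)%R, M] <= (2 * M / s)%:E)%E.
Proof.
move=> s0 M0; rewrite /normal_prob.
apply: (@le_trans _ _ (\int[lebesgue_measure]_(x in `[(- M)%R, M]) (s^-1)%:E)%E).
  apply: ge0_le_integral => //=.
  - by move=> x _; rewrite lee_fin normal_pdf_ge0.
  - by apply/measurable_EFinP/measurable_funTS; exact: measurable_normal_pdf.
  - move=> x _; rewrite lee_fin (le_trans _ (normal_peak_le s0))//.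
    by rewrite normal_pdf_ub ?lt0r_neq0.
rewrite integral_cst//= lebesgue_measure_itv/= lte_fin.
(* The length formula singles out the degenerate interval, which arises for [M = 0]. *)
case: ifP => _; last by rewrite mule0 lee_fin divr_ge0 ?mulr_ge0// ltW.
by rewrite -EFinD -EFinM lee_fin opprK mulrC mulr_natl mulr2n.
Qed.

(* A centered normal variable of standard deviation [s] puts mass at most
   [2 M / s] on [[-M, M]], so that the mass bound forces [s <= 4 M]. *)
Lemma centered_normal_second_moment_le d (Omega : measurableType d)
    (P : probability Omega R) (X : Omega -> R) (M : R) :
  measurable_fun setT X -> centered_normal P X -> 0 <= M ->
  (2^-1%:E <= P [set w | `|X w| <= M]%R)%E ->
  (\int[P]_w (X w ^+ 2)%:E <= (96 * M ^+ 2)%:E)%E.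
Proof.
move=> mX cX M0 PM.
have msqr : measurable_fun setT (fun x : R => (x ^+ 2)%:E).
  by apply/measurable_EFinP; exact: measurable_funX.
have -> : (\int[P]_w (X w ^+ 2)%:E =
    \int[pushforward P (X : Omega -> measurableTypeR R)]_x (x ^+ 2)%:E)%E.
  by rewrite ge0_integral_pushforward// => x _; rewrite lee_fin sqr_ge0.
case: cX => [dX|[s s0 nX]].
  rewrite (@eq_measure_integral _ _ _ _ (\d_ (0 : measurableTypeR R))); last first.
    by move=> A mA _; exact: dX.
  by rewrite integral_dirac// diracE/= in_setT mul1e lee_fin expr0n/= mulr_ge0 ?sqr_ge0.
rewrite (@eq_measure_integral _ _ _ _ (normal_prob 0 s)); last first.
  by move=> A mA _; exact: nX.
apply: le_trans (normal_second_moment_le s0) _; rewrite lee_fin.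
(* With this bound, [6 s ^+ 2] is at most [6 * 16 * M ^+ 2], whence the constant 96. *)
have sM : s <= 4 * M.
  have := normal_prob_centered_itv_le s0 M0; rewrite -nX//= /pushforward.
  have -> : X @^-1` `[(- M)%R, M] = [set w | `|X w| <= M].
    by apply/seteqP; split => w /=; rewrite in_itv/= ler_norml.
  move=> /(le_trans PM); rewrite lee_fin ler_pdivlMr//; lra.
have : s ^+ 2 <= (4 * M) ^+ 2 by rewrite ler_sqr ?nnegrE ?mulr_ge0// ltW.
by rewrite exprMn; lra.
Qed.

End normal_moment.

(** * Integrability of continuous linear functionals *)

(** An injection of [D] into [nat] is inverted by [get]; indices outside its range yield arbitrary
    points, which do no harm to density. *)
Lemma separable_dense_sequence (R : realType) (B : normedModType R) :
  separable B -> exists u : nat -> B,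
    forall (x : B) (e : R), 0 < e -> exists n, `|x - u n| < e.
Proof.
move=> [D /countable_injP[f finj] dD].
exists (fun n => get [set x | D x /\ f x = n]) => x e e0.
have [] := dD (ball x e); first by exists x; exact: ballxx.
  exact: ball_open.
move=> y [xy Dy]; exists (f y).
have [] : [set z | D z /\ f z = f y] (get [set z | D z /\ f z = f y]).
  by apply: getPex; exists y.
set z := get _ => Dz fzy.
have -> : z = y by apply: finj => //; apply/mem_set.
by move: xy; rewrite -ball_normE.
Qed.

Section square_integrable.
Context d (Omega : measurableType d) (R : realType).
Context (mu : {measure set Omega -> \bar R}).

Lemma integrable_mul (X Y : Omega -> R) :
  measurable_fun setT X -> measurable_fun setT Y ->
  mu.-integrable setT (fun w => (X w ^+ 2)%:E) ->
  mu.-integrable setT (fun w => (Y w ^+ 2)%:E) ->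
  mu.-integrable setT (fun w => (X w * Y w)%:E).
Proof.
move=> mX mY iX iY.
apply: le_integrable (integrableD measurableT iX iY) => //.
  by apply/measurable_EFinP; exact: measurable_funM.
move=> w _ /=; rewrite lee_fin normrM [leRHS]ger0_norm ?addr_ge0 ?sqr_ge0//.
rewrite -[X w ^+ 2]real_normK ?num_real// -[Y w ^+ 2]real_normK ?num_real//.
have := sqr_ge0 (`|X w| - `|Y w|); have := sqr_ge0 (`|X w| + `|Y w|); lra.
Qed.

Lemma integrable_sqrP (X : Omega -> R) (c : R) : measurable_fun setT X ->
  (\int[mu]_w (X w ^+ 2)%:E <= c%:E)%E ->
  mu.-integrable setT (fun w => (X w ^+ 2)%:E).
Proof.
move=> mX Xc; apply/integrableP; split.
  by apply/measurable_EFinP; exact: measurable_funX.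
under eq_integral do rewrite gee0_abs ?lee_fin ?sqr_ge0//.
exact: le_lt_trans Xc (ltry _).
Qed.

End square_integrable.

Lemma dual_bound (R : realType) (B : normedModType R) (b : {linear B -> R^o}) :
  dual B b -> exists2 L, 0 < L & forall y, `|b y| <= L * `|y|.
Proof.
move=> db; have /linear_boundedP := continuous_linear_bounded 0 (db 0).
move=> /pinfty_ex_gt0[L L0 bL]; exists L => //.
Qed.

Section gaussian_element.
Context (R : realType) d (Omega : measurableType d) (P : probability Omega R).
Context (B : completeNormedModType R) (W : Omega -> B).
Hypothesis gW : zero_mean_gaussian P W.
Implicit Types b c : {linear B -> R^o}.

Lemma measurable_preimage_open U : open U -> measurable (W @^-1` U).
Proof.
move=> oU; rewrite -[W @^-1` U]setTI; apply: gW.1 => //.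
exact: sub_sigma_algebra.
Qed.

Lemma measurable_continuous_comp (f : B -> R) :
  continuous f -> measurable_fun setT (f \o W).
Proof.
move=> cf; apply: (measurability _ (RGenOpens.measurableE R)).
move=> _ [_ [x [y ->]] <-]; rewrite setTI comp_preimage.
apply: measurable_preimage_open; apply: open_comp => [z _|]; first exact: cf.
exact: interval_open.
Qed.

Lemma dual_measurable b : dual B b -> measurable_fun setT (b \o W).
Proof. by move=> db; exact: measurable_continuous_comp. Qed.

(** The events [|W| < n] increase to the whole space, so their probabilities tend to 1. *)
Lemma norm_half_quantile : exists2 M : R, 0 <= M &
  (2^-1%:E <= P [set w | (`|W w| < M)%R])%E.
Proof.
pose F (n : nat) := [set w | `|W w| < n%:R].
have mnorm : measurable_fun setT (fun w => `|W w|).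
  apply: (measurable_continuous_comp (f := fun x => `|x|)).
  exact: norm_continuous.
have mF n : measurable (F n).
  apply: (@measurable_preimage_open [set x | `|x| < n%:R]).
  apply: (@open_comp _ _ (fun x : B => `|x|) [set x | x < n%:R]).
    by move=> x _; exact: norm_continuous.
  exact: open_lt.
have UF : \bigcup_n F n = setT.
  apply/seteqP; split => // w _; exists (Num.truncn `|W w|).+1 => //.
  by rewrite /F /= truncnS_gt.
have : fine (P (F n)) @[n --> \oo] --> (1 : R).
  apply: fine_cvg; rewrite -(@probability_setT _ _ _ P) -UF.
  apply: nondecreasing_cvg_mu => //; first exact: bigcup_measurable.
  move=> m n mn; apply/subsetPset => w; rewrite /F /= => /lt_le_trans; apply.
  by rewrite ler_nat.
move=> /(cvgr_gt _)/(_ 2^-1); case; first by rewrite invf_lt1 ?ltr1n.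
move=> n _ /(_ n (leqnn n)) /= Pn; exists n%:R => //.
by rewrite -(fineK (fin_num_measure P _ (mF n))) lee_fin ltW.
Qed.

(** The single event [|W| < M] confines every [b(W)] to absolute values at most [L * M], so one
    constant serves all functionals. *)
Lemma second_moment_le : exists2 C : R, 0 <= C & forall b L,
  dual B b -> 0 <= L -> (forall y, `|b y| <= L * `|y|) ->
  (\int[P]_w (b (W w) ^+ 2)%:E <= (C * L ^+ 2)%:E)%E.
Proof.
have [M M0 PM] := norm_half_quantile.
exists (96 * M ^+ 2); first by rewrite mulr_ge0 ?sqr_ge0.
move=> b L db L0 bL; rewrite -mulrA -exprMn [M * L]mulrC.
have mb := dual_measurable db.
apply: (centered_normal_second_moment_le mb (gW.2 _ db)).
  exact: mulr_ge0.
apply: le_trans PM _; apply: le_measure; rewrite ?inE.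
- apply: (@measurable_preimage_open [set x | `|x| < M]).
  apply: (@open_comp _ _ (fun x : B => `|x|) [set x | x < M]).
    by move=> x _; exact: norm_continuous.
  exact: open_lt.
- rewrite (_ : [set _ | _] = setT `&` (b \o W) @^-1` `[- (L * M), L * M]).
    by apply: mb => //; exact: measurable_itv.
  by rewrite setTI; apply/seteqP; split => w /=; rewrite in_itv/= ler_norml.
- move=> w /= WM; apply: le_trans (bL _) _.
  by apply: ler_wpM2l => //; exact: ltW.
Qed.

Lemma dual_sqr_integrable b : dual B b ->
  P.-integrable setT (fun w => (b (W w) ^+ 2)%:E).
Proof.
move=> db; have [C C0 bC] := second_moment_le.
have [L L0 bL] := dual_bound db.
by apply: integrable_sqrP (dual_measurable db) (bC _ _ db (ltW L0) bL).
Qed.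

Lemma dual_mul_integrable b c : dual B b -> dual B c ->
  P.-integrable setT (fun w => (b (W w) * c (W w))%:E).
Proof.
move=> db dc; apply: integrable_mul; try exact: dual_measurable;
  exact: dual_sqr_integrable.
Qed.

End gaussian_element.

(** * Existence of the Pettis integral *)

Lemma cauchy_seq_cvg (R : realType) (B : completeNormedModType R)
    (x : nat -> B) :
  (forall e : R, 0 < e -> exists N : nat, forall m n : nat,
    (N <= m)%N -> (N <= n)%N -> `|x m - x n| < e) -> cvg (x n @[n --> \oo]).
Proof.
move=> xC; apply/cauchy_cvgP/cauchy_exP => e e0; have [N hN] := xC e e0.
exists (x N); exists N => // n /= Nn; rewrite -ball_normE /=; exact: hN.
Qed.

Lemma invSn_lt (R : realType) (e : R) : 0 < e ->
  exists N : nat, forall n : nat, (N <= n)%N -> n.+1%:R^-1 < e.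
Proof.
move=> e0; have [N _ hN] := near_infty_natSinv_lt (PosNum e0).
by exists N => n Nn; exact: hN.
Qed.

Section pettis_existence.
Context (R : realType) d (Omega : measurableType d) (P : probability Omega R).
Context (B : completeNormedModType R) (W : Omega -> B).
Hypotheses (sepB : separable B) (gW : zero_mean_gaussian P W).
Implicit Types b c : {linear B -> R^o}.

Let integrable_on (f : Omega -> R) D : measurable D ->
  P.-integrable setT (EFin \o f) -> P.-integrable D (EFin \o f).
Proof. by move=> mD; apply: integrableS. Qed.

Let integrable_dual b : dual B b -> P.-integrable setT (EFin \o (b \o W)).
Proof.
move=> db; have ic := finite_measure_integrable_cst P 1 measurableT.
rewrite (_ : EFin \o _ = fun w => (b (W w) * cst 1 w)%:E); last first.
  by apply/funext => w /=; rewrite mulr1.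
apply: integrable_mul => //; first exact: (dual_measurable gW db).
  exact: dual_sqr_integrable.
by rewrite (_ : (fun=> _) = EFin \o cst 1)//; apply/funext => w /=; rewrite expr1n.
Qed.

Let integrableZ (a : R) D (f : Omega -> R) : measurable D ->
  P.-integrable D (EFin \o f) -> P.-integrable D (EFin \o (fun w => a * f w)).
Proof. by move=> mD; exact: integrableZl. Qed.

Let integrableDf D (f g : Omega -> R) : measurable D ->
  P.-integrable D (EFin \o f) -> P.-integrable D (EFin \o g) ->
  P.-integrable D (EFin \o (fun w => f w + g w)).
Proof. by move=> mD If Ig; exact: (integrableD mD If Ig). Qed.

Let integrableBf D (f g : Omega -> R) : measurable D ->
  P.-integrable D (EFin \o f) -> P.-integrable D (EFin \o g) ->
  P.-integrable D (EFin \o (fun w => f w - g w)).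
Proof. by move=> mD If Ig; exact: (integrableB mD If Ig). Qed.

Let E (u : nat -> B) (e : R) n := W @^-1` ball (u n) e.
Let F u e n := \big[setU/set0]_(i < n) E u e i.

Let mE u e n : 0 < e -> measurable (E u e n).
Proof. by move=> e0; apply: (measurable_preimage_open gW); exact: ball_open. Qed.

Let mF u e n : 0 < e -> measurable (F u e n).
Proof. by move=> e0; apply: bigsetU_measurable => i _; exact: mE. Qed.

(* [x] integrates [b \o W] against the simple function that rounds [W] to the
   first of the [u i], [i < n], at distance less than [e]. *)
Lemma simple_pettis b u e n : dual B b -> 0 < e ->
  exists x : B, forall c L, dual B c -> 0 < L ->
    (forall y, `|c y| <= L * `|y|) ->
    `|c x - \int[P]_(w in F u e n) (c (W w) * b (W w))| <=
    L * e * \int[P]_(w in F u e n) `|b (W w)|.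
Proof.
move=> db e0.
have ib : P.-integrable setT (EFin \o (b \o W)).
  exact: integrable_dual.
have ibn : P.-integrable setT (EFin \o (fun w => `|b (W w)|)).
  exact: integrable_norm ib.
elim: n => [|n [x hx]].
  exists 0 => c L dc L0 cL.
  by rewrite /F big_ord0 !Rintegral_set0 linear0 subrr normr0 mulr0.
(* The event that [u n] is the first point within [e] of [W]: there [W] is rounded to [u n], which
   adds the multiple of [u n] in the new witness. *)
set A := E u e n `\` F u e n.
have mFn := mF u n e0; have mEn := mE u n e0.
have mA : measurable A by exact: measurableD.
have FA : F u e n.+1 = F u e n `|` A.
  by rewrite /F big_ord_recr/= /A setDE setUIr setUCr setIT.
have dFA : [disjoint F u e n & A].
  by apply/disj_setPS => w [Fw []].
exists (x + (\int[P]_(w in A) b (W w)) *: u n) => c L dc L0 cL.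
have icb := dual_mul_integrable gW dc db.
rewrite FA !Rintegral_setU//; try exact: integrable_on (measurableU _ _ mFn mA) _.
rewrite linearD linearZ/= opprD addrACA (le_trans (ler_normD _ _))// mulrDr.
apply: lerD; first exact: hx.
have iA : P.-integrable A (EFin \o (b \o W)) by exact: integrable_on.
have -> : (\int[P]_(w in A) b (W w)) *: (c (u n) : R^o) =
    \int[P]_(w in A) (b (W w) * c (u n)).
  by rewrite RintegralZr.
have icA : P.-integrable A (EFin \o (fun w => b (W w) * c (u n))).
  under eq_fun do rewrite mulrC.
  exact: integrableZ.
have icbA : P.-integrable A (EFin \o (fun w => c (W w) * b (W w))).
  exact: integrable_on.
have iBA : P.-integrable A
    (EFin \o (fun w => b (W w) * c (u n) - c (W w) * b (W w))).
  exact: integrableBf.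
rewrite -RintegralB//.
apply: le_trans (le_normr_Rintegral _ _) _ => //.
rewrite -RintegralZl//; last exact: integrable_on.
apply: le_Rintegral => //.
- exact: integrable_norm iBA.
- by apply: integrableZ => //; exact: integrable_on.
move=> w [/= Ew _].
(* The integrand is [c (u n - W) * b (W)], and [W] is within [e] of [u n] on [A]. *)
rewrite mulrC -mulrBl normrM ler_wpM2r// -linearB (le_trans (cL _))//.
by apply: (ler_wpM2l (ltW L0)); apply: ltW; move: Ew; rewrite /E /= -ball_normE.
Qed.

(** Young's inequality. The weight [1 / L] on [x ^+ 2] is meant for a second moment of order
    [L ^+ 2], so that the final bound is linear in [L]. *)
Let weighted_AMGM (x y s L : R) : 0 < s -> 0 < L ->
  `|x| * `|y| <= s / 2 / L * x ^+ 2 + L / (2 * s) * y ^+ 2.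
Proof.
move=> s0 L0; rewrite -subr_ge0.
have -> : s / 2 / L * x ^+ 2 + L / (2 * s) * y ^+ 2 - `|x| * `|y| =
    (s * `|x| - L * `|y|) ^+ 2 / (2 * s * L).
  rewrite -[x ^+ 2]real_normK ?num_real// -[y ^+ 2]real_normK ?num_real//.
  by field; rewrite !lt0r_neq0.
by rewrite divr_ge0 ?sqr_ge0// !mulr_ge0// ltW.
Qed.

(** The error has three parts of at most [L * e / 3]: the rounding on [F u r n], and, on its
    complement, the two terms of Young's inequality, in [c(W)] and in [b(W)]. *)
Lemma approx_pettis b e : dual B b -> 0 < e ->
  exists x : B, forall c L, dual B c -> 0 < L ->
    (forall y, `|c y| <= L * `|y|) ->
    `|c x - \int[P]_w (c (W w) * b (W w))| <= L * e.
Proof.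
move=> db e0; have [u udense] := separable_dense_sequence sepB.
have [C C0 hC] := second_moment_le gW.
set K := \int[P]_w `|b (W w)|.
have K0 : 0 <= K by apply: Rintegral_ge0.
(* [r] controls the rounding and [t] the term in [c(W)]; adding 1 keeps the denominators positive
   when [K] or [C] vanishes. *)
pose r := e / (3 * (K + 1)); pose t := 2 * e / (3 * (C + 1)).
have r0 : 0 < r by rewrite divr_gt0// mulr_gt0// ltr_wpDl.
have t0 : 0 < t by rewrite divr_gt0 ?mulr_gt0// ltr_wpDl.
have ib := integrable_dual db; have ib2 := dual_sqr_integrable gW db.
have [n Fn] : exists n, \int[P]_(w in ~` F u r n) (b (W w) ^+ 2) < 2 * t * e / 3.
  have te0 : 0 < 2 * t * e / 3 by rewrite divr_gt0// mulr_gt0// mulr_gt0.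
  (* Absolute continuity of the integral: the complement of [F u r n] has probability below [s] for
     large [n], as [u] is dense. *)
  have [/= s [s0 hs]] := integral_normr_continuous ib2 te0.
  have PF : fine (P (F u r n)) @[n --> \oo] --> (1 : R).
    apply: fine_cvg; rewrite -(@probability_setT _ _ _ P).
    have <- : \bigcup_n F u r n = setT.
      apply/seteqP; split => // w _; have [n Wn] := udense (W w) r r0.
      exists n.+1 => //; rewrite /F big_ord_recr/=; right.
      by rewrite /E /= -ball_normE /= distrC.
    apply: nondecreasing_cvg_mu => [n||m n mn]; first exact: mF.
      by apply: bigcup_measurable => n _; exact: mF.
    by apply/subsetPset; rewrite /F; apply: subset_bigsetU.
  have s1 : 1 - s < 1 by rewrite ltrBlDr ltrDl.
  have [n _ /(_ n (leqnn n)) /= sn] := cvgr_gt _ PF _ s1.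
  exists n; have mFn := mF u n r0.
  rewrite (@eq_Rintegral _ _ _ _ _ (fun w => `|b (W w) ^+ 2|)); last first.
    by move=> w _; rewrite ger0_norm ?sqr_ge0.
  apply: hs; first exact: measurableC.
  rewrite probability_setC// -(fineK (fin_num_measure P _ mFn)) lte_fin.
  lra.
have mFn := mF u n r0; have mFnC : measurable (~` F u r n) by exact: measurableC.
have [x hx] := simple_pettis u n db r0.
exists x => c L dc L0 cL.
have icb := dual_mul_integrable gW dc db; have ic2 := dual_sqr_integrable gW dc.
have -> : \int[P]_w (c (W w) * b (W w)) =
    \int[P]_(w in F u r n) (c (W w) * b (W w)) +
    \int[P]_(w in ~` F u r n) (c (W w) * b (W w)).
  rewrite -Rintegral_setU//; first by rewrite setUv.
  - by rewrite setUv.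
  - by apply/disj_setPCl.
rewrite opprD addrA (le_trans (ler_normB _ _))//.
have h1 : L * r * \int[P]_(w in F u r n) `|b (W w)| <= L * (e / 3).
  rewrite -mulrA; apply: (ler_wpM2l (ltW L0)); apply: (@le_trans _ _ (r * K)).
    apply: (ler_wpM2l (ltW r0)); rewrite /K -(setUv (F u r n)) Rintegral_setU//.
    - by rewrite lerDl Rintegral_ge0.
    - by rewrite setUv; exact: integrable_norm ib.
    - by apply/disj_setPCl.
  rewrite /r mulrAC ler_pdivrMr ?mulr_gt0 ?ltr_wpDl//; nra.
have h2 : `|\int[P]_(w in ~` F u r n) (c (W w) * b (W w))| <= L * (e * 2 / 3).
  apply: le_trans (le_normr_Rintegral _ _) _ => //; first exact: integrable_on.
  pose g w := t / 2 / L * c (W w) ^+ 2 + L / (2 * t) * b (W w) ^+ 2.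
  have icZ : P.-integrable setT (EFin \o (fun w => t / 2 / L * c (W w) ^+ 2)).
    exact: integrableZ.
  have ibZ : P.-integrable setT (EFin \o (fun w => L / (2 * t) * b (W w) ^+ 2)).
    exact: integrableZ.
  have ig : P.-integrable setT (EFin \o g) by exact: integrableDf.
  apply: (@le_trans _ _ (\int[P]_(w in ~` F u r n) g w)).
    apply: le_Rintegral => //.
    - by apply: integrable_on => //; exact: integrable_norm icb.
    - exact: integrable_on.
    by move=> w _; rewrite /g normrM weighted_AMGM.
  rewrite RintegralD//; [|exact: integrable_on|exact: integrable_on].
  rewrite !RintegralZl//; [|exact: integrable_on|exact: integrable_on].
  have h3 : \int[P]_(w in ~` F u r n) (c (W w) ^+ 2) <= C * L ^+ 2.
    apply: (@le_trans _ _ (\int[P]_w (c (W w) ^+ 2))).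
      rewrite -(setUv (F u r n)) Rintegral_setU//.
      - by rewrite lerDr Rintegral_ge0// => w _; exact: sqr_ge0.
      - by rewrite setUv.
      - by apply/disj_setPCl.
    have := hC _ _ dc (ltW L0) cL.
    rewrite /Rintegral -[X in (X <= _)%E -> _]fineK//.
    exact: (integrable_fin_num measurableT ic2).
  have hc : t / 2 / L * \int[P]_(w in ~` F u r n) (c (W w) ^+ 2) <= L * (e / 3).
    apply: (@le_trans _ _ (t / 2 / L * (C * L ^+ 2))).
      by apply: ler_wpM2l => //; apply/ltW/divr_gt0 => //; exact: divr_gt0.
    have -> : t / 2 / L * (C * L ^+ 2) = L * (t / 2 * C).
      by field; rewrite lt0r_neq0.
    apply: (ler_wpM2l (ltW L0)); rewrite /t.
    have -> : 2 * e / (3 * (C + 1)) / 2 * C = e / 3 * (C / (C + 1)).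
      by field; rewrite lt0r_neq0// ltr_wpDl.
    have C1 : 0 < C + 1 by rewrite ltr_wpDl.
    by apply: ler_piMr; [rewrite divr_ge0// ltW|rewrite ler_pdivrMr// mul1r lerDl].
  have hb : L / (2 * t) * \int[P]_(w in ~` F u r n) (b (W w) ^+ 2) <= L * (e / 3).
    apply: (@le_trans _ _ (L / (2 * t) * (2 * t * e / 3))).
      apply: ler_wpM2l; last exact: ltW.
      by apply/ltW/divr_gt0 => //; exact: mulr_gt0.
    by rewrite le_eqVlt; apply/orP; left; apply/eqP; field; rewrite lt0r_neq0.
  lra.
have := hx _ _ dc L0 cL; lra.
Qed.

(** The error bound is uniform over functionals of norm at most 1, so testing [x m - x n] with a
    norming functional shows that the approximations are Cauchy in [B]. *)
Lemma pettis_exists b : dual B b -> exists x : B, forall c, dual B c ->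
  c x = \int[P]_w (c (W w) * b (W w)).
Proof.
move=> db.
have /choice[x hx] : forall n : nat, exists x : B, forall c L, dual B c -> 0 < L ->
    (forall y, `|c y| <= L * `|y|) ->
    `|c x - \int[P]_w (c (W w) * b (W w))| <= L * n.+1%:R^-1.
  by move=> n; apply: approx_pettis.
have xn m n : `|x m - x n| <= m.+1%:R^-1 + n.+1%:R^-1.
  have [f df [fle <-]] := norming_functional (x m - x n).
  have fle1 y : `|f y| <= 1 * `|y| by rewrite mul1r.
  rewrite linearB; apply: le_trans (ler_norm _) _.
  apply: le_trans (ler_distD (\int[P]_w (f (W w) * b (W w))) _ _) _.
  rewrite [X in _ + X]distrC -[m.+1%:R^-1]mul1r -[n.+1%:R^-1]mul1r.
  by apply: lerD; exact: hx.
have cx : cvg (x n @[n --> \oo]).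
  apply: cauchy_seq_cvg => e e0.
  have e2 : 0 < e / 2 by rewrite divr_gt0.
  have [N hN] := invSn_lt e2.
  exists N => m n Nm Nn; apply: le_lt_trans (xn m n) _.
  by rewrite [e]splitr; apply: ltrD; exact: hN.
exists (lim (x n @[n --> \oo])) => c dc.
have [L L0 cL] := dual_bound dc.
have clim : c (x n) @[n --> \oo] --> c (lim (x n @[n --> \oo])).
  by apply: cvg_comp; [exact: cx|exact: dc].
have cI : c (x n) @[n --> \oo] --> \int[P]_w (c (W w) * b (W w)).
  apply/cvgrPdist_lt => e e0.
  have [N hN] := invSn_lt (divr_gt0 e0 L0).
  exists N => // n /= /hN; rewrite ltr_pdivlMr// mulrC => /le_lt_trans; apply.
  by rewrite distrC hx.
exact: norm_cvg_unique clim cI.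
Qed.

End pettis_existence.

(** * The covariance form on the dual *)

Section lincomb.
Context (R : realType) (B : normedModType R).
Implicit Types b c : {linear B -> R^o}.

(** Sums and differences are both instances; in particular [lincomb (-1) b c] is [c - b]. *)
Definition lincomb (a : R) b c : {linear B -> R^o} := ( *:%R a \o b) \+ c.

Lemma lincombE a b c x : lincomb a b c x = a * b x + c x.
Proof. by []. Qed.

Lemma dual_lincomb a b c : dual B b -> dual B c -> dual B (lincomb a b c).
Proof. by move=> db dc x; apply: cvgD; [apply: cvgZr; exact: db|exact: dc]. Qed.

Lemma dual_comp (B' : normedModType R) (T : {linear B' -> B}) b :
  continuous T -> dual B b -> dual B' (b \o T).
Proof. by move=> cT db x; apply: cvg_comp; [exact: cT|exact: db]. Qed.

End lincomb.

Lemma discriminant_le (R : realFieldType) (a r s : R) : 0 <= s ->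
  (forall t, 0 <= a - 2 * t * r + t ^+ 2 * s) -> r ^+ 2 <= a * s.
Proof.
rewrite le_eqVlt => /predU1P[<-|s0] h.
  have [->|r0] := eqVneq r 0; first by rewrite expr0n mulr0.
  (* For [s = 0] the expression is affine in [t], and this [t] gives it the value -1. *)
  have := h ((a + 1) / (2 * r)).
  have -> : a - 2 * ((a + 1) / (2 * r)) * r = - 1 by field.
  lra.
(* The minimizer of the quadratic. *)
have := h (r / s).
have -> : a - 2 * (r / s) * r + (r / s) ^+ 2 * s = (a * s - r ^+ 2) / s.
  by field; rewrite lt0r_neq0.
by rewrite pmulr_lge0 ?invr_gt0// subr_ge0.
Qed.

Section dual_covariance.
Context (R : realType) d (Omega : measurableType d) (P : probability Omega R).
Context (B : completeNormedModType R) (W : Omega -> B).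
Implicit Types b c e : {linear B -> R^o}.

Definition dcov b c : R := \int[P]_w (b (W w) * c (W w)).

(** This hypothesis and [exW] below stand in for Gaussianity and separability, so that the section
    applies to [W] and also to [T \o W], whose space is not assumed separable. *)
Hypothesis intW : forall b c, dual B b -> dual B c ->
  P.-integrable setT (fun w => (b (W w) * c (W w))%:E).

Lemma dcovC b c : dcov b c = dcov c b.
Proof. by apply: eq_Rintegral => w _; rewrite mulrC. Qed.

Lemma dcov_ge0 b : 0 <= dcov b b.
Proof. by apply: Rintegral_ge0 => w _; exact: sqr_ge0. Qed.

Lemma dcov_lincombl a b c e : dual B b -> dual B c -> dual B e ->
  dcov (lincomb a b c) e = a * dcov b e + dcov c e.
Proof.
move=> db dc de; rewrite /dcov -RintegralZl//; last exact: intW.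
rewrite -RintegralD//; [|exact: (integrableZl measurableT a (intW db de))|exact: intW].
by apply: eq_Rintegral => w _; rewrite /lincomb/= mulrDl mulrA.
Qed.

Lemma dcov_lincombr a b c e : dual B b -> dual B c -> dual B e ->
  dcov e (lincomb a b c) = a * dcov e b + dcov e c.
Proof. by move=> db dc de; rewrite dcovC dcov_lincombl// !(dcovC e). Qed.

Lemma dcov_lincomb a b c : dual B b -> dual B c ->
  dcov (lincomb a b c) (lincomb a b c) =
  a ^+ 2 * dcov b b + 2 * a * dcov b c + dcov c c.
Proof.
move=> db dc; rewrite dcov_lincombl ?dcov_lincombr//; try exact: dual_lincomb.
by rewrite (dcovC c b); ring.
Qed.

Lemma dcov_CauchySchwarz b c : dual B b -> dual B c ->
  dcov b c ^+ 2 <= dcov b b * dcov c c.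
Proof.
move=> db dc; apply: discriminant_le => [|t]; first exact: dcov_ge0.
have := dcov_ge0 (lincomb (- t) c b); rewrite dcov_lincomb// (dcovC c b); lra.
Qed.

(** A seminorm on the dual, which becomes the RKHS-norm on Pettis integrals. *)
Definition dual_norm2 b : R := Num.sqrt (dcov b b).

Lemma dual_norm2_lincomb a b c : dual B b -> dual B c ->
  dual_norm2 (lincomb a b c) <= `|a| * dual_norm2 b + dual_norm2 c.
Proof.
move=> db dc; rewrite -[leRHS]ger0_norm ?addr_ge0 ?mulr_ge0 ?sqrtr_ge0//.
rewrite -sqrtr_sqr ler_wsqrtr// dcov_lincomb// sqrrD exprMn real_normK ?num_real//.
rewrite !sqr_sqrtr ?dcov_ge0// lerD2r lerD2l.
suff : a * dcov b c <= `|a| * (dual_norm2 b * dual_norm2 c) by lra.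
apply: le_trans (ler_norm _) _; rewrite normrM ler_wpM2l//.
by rewrite -sqrtrM ?dcov_ge0// -sqrtr_sqr ler_wsqrtr// dcov_CauchySchwarz.
Qed.

Lemma dual_norm2N b c : dual B b -> dual B c ->
  dual_norm2 (lincomb (-1) b c) = dual_norm2 (lincomb (-1) c b).
Proof.
move=> db dc; congr Num.sqrt; rewrite !dcov_lincomb// (dcovC c b); ring.
Qed.

Lemma dual_norm2_le_add b c : dual B b -> dual B c ->
  dual_norm2 b <= dual_norm2 (lincomb (-1) c b) + dual_norm2 c.
Proof.
move=> db dc; have dbc : dual B (lincomb (-1) c b) by exact: dual_lincomb.
have := dual_norm2_lincomb 1 dbc dc; rewrite normr1 mul1r; apply: le_trans.
rewrite le_eqVlt; apply/orP; left; apply/eqP; congr Num.sqrt.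
rewrite !dcov_lincomb// dcov_lincombl// (dcovC c b); ring.
Qed.

Lemma dual_norm2_dist b c : dual B b -> dual B c ->
  `|dual_norm2 b - dual_norm2 c| <= dual_norm2 (lincomb (-1) b c).
Proof.
move=> db dc; have := dual_norm2_le_add db dc; have := dual_norm2_le_add dc db.
by rewrite (dual_norm2N dc db) ler_norml; lra.
Qed.

(** [x1 - x2] telescopes through [b1] and [b2]. This transfers the Cauchy property from functionals
    to their approximants. *)
Lemma dual_norm2_triangle3 x1 b1 b2 x2 :
  dual B x1 -> dual B b1 -> dual B b2 -> dual B x2 ->
  dual_norm2 (lincomb (-1) x2 x1) <= dual_norm2 (lincomb (-1) x1 b1) +
    dual_norm2 (lincomb (-1) b2 b1) + dual_norm2 (lincomb (-1) x2 b2).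
Proof.
move=> dx1 db1 db2 dx2; rewrite (dual_norm2N dx1 db1).
have d1 : dual B (lincomb (-1) b1 x1) by exact: dual_lincomb.
have d2 : dual B (lincomb (-1) b2 b1) by exact: dual_lincomb.
have d3 : dual B (lincomb (-1) x2 b2) by exact: dual_lincomb.
have d12 : dual B (lincomb 1 (lincomb (-1) b1 x1) (lincomb (-1) b2 b1)).
  exact: dual_lincomb.
have := dual_norm2_lincomb 1 d1 d2; have := dual_norm2_lincomb 1 d12 d3.
rewrite normr1 !mul1r => h1 h2.
apply: le_trans (le_trans h1 _); last by rewrite lerD2r.
rewrite le_eqVlt; apply/orP; left; apply/eqP; congr Num.sqrt.
by apply: eq_Rintegral => w _; rewrite !lincombE; ring.
Qed.

Hypothesis exW : forall b, dual B b ->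
  exists x : B, forall c, dual B c -> c x = dcov c b.

Lemma expectation_dcov b c : dual B b -> dual B c ->
  ('E_P[fun w => (b (W w) * c (W w))%R])%E = (dcov b c)%:E.
Proof.
move=> db dc; rewrite unlock /dcov /Rintegral fineK//.
exact: (integrable_fin_num measurableT (intW db dc)).
Qed.

Lemma dual_pettis b c : dual B b -> dual B c -> c (pettis P W b) = dcov c b.
Proof.
move=> db dc; have [x hx] := exW db; apply: EFin_inj.
rewrite -expectation_dcov//.
suff : [set x | forall b2, dual B b2 ->
    (b2 x)%:E = 'E_P[fun w => (b2 (W w) * b (W w))%R]%E] (pettis P W b) by exact.
by apply: getPex; exists x => b2 db2; rewrite expectation_dcov ?hx.
Qed.

Lemma pettis_unique b x : dual B b ->
  (forall c, dual B c -> c x = dcov c b) -> pettis P W b = x.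
Proof. by move=> db hx; apply: dual_separates => c dc; rewrite dual_pettis ?hx. Qed.

Lemma pettis_lincomb a b c : dual B b -> dual B c ->
  pettis P W (lincomb a b c) = a *: pettis P W b + pettis P W c.
Proof.
move=> db dc; apply: pettis_unique => [|e de]; first exact: dual_lincomb.
by rewrite linearD linearZ/= !dual_pettis// dcov_lincombr.
Qed.

Lemma pettisB b c : dual B b -> dual B c ->
  pettis P W b - pettis P W c = pettis P W (lincomb (-1) c b).
Proof. by move=> db dc; rewrite pettis_lincomb// scaleN1r addrC. Qed.

Lemma pettis_innerE b c : dual B b -> dual B c ->
  pettis_inner P W (pettis P W b) (pettis P W c) = dcov b c.
Proof.
move=> db dc; rewrite /pettis_inner; set A := [set r | _].
have : A (get A).
  by apply: getPex; exists (dcov b c), b, c; split; rewrite // expectation_dcov.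
move: (get A) => r [b1 [b2 [db1 db2 b1E b2E]]]; rewrite expectation_dcov// => -[->].
(* The representatives may differ from [b] and [c] and are exchanged one at a time: with [S] the
   Pettis integral, [b1 (S b2) = b1 (S c) = c (S b1) = c (S b)]. *)
by rewrite -dual_pettis// b2E dual_pettis// dcovC -dual_pettis// b1E dual_pettis// dcovC.
Qed.

Lemma pettis_normE b : dual B b -> pettis_norm P W (pettis P W b) = dual_norm2 b.
Proof. by move=> db; rewrite /pettis_norm pettis_innerE. Qed.

Lemma pettis_normBE b c : dual B b -> dual B c ->
  pettis_norm P W (pettis P W b - pettis P W c) = dual_norm2 (lincomb (-1) c b).
Proof. by move=> db dc; rewrite pettisB// pettis_normE//; exact: dual_lincomb. Qed.

End dual_covariance.

(** * Images under injective continuous linear maps *)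

Lemma dual0 (R : realType) (B : normedModType R) : dual B \0.
Proof. by move=> x; exact: cvg_cst. Qed.

Section image.
Context (R : realType) d (Omega : measurableType d) (P : probability Omega R).
Context (B B' : completeNormedModType R) (T : {linear B -> B'}) (W : Omega -> B).
Hypotheses (sepB : separable B) (injT : injective T) (cT : continuous T).
Hypothesis gW : zero_mean_gaussian P W.

Let intW := dual_mul_integrable gW.
Let exW := pettis_exists sepB gW.

Let dT b' : dual B' b' -> dual B (b' \o T).
Proof. exact: dual_comp. Qed.

Let intTW b' c' : dual B' b' -> dual B' c' ->
  P.-integrable setT (fun w => (b' ((T \o W) w) * c' ((T \o W) w))%:E).
Proof. by move=> db dc; exact: (intW (dT db) (dT dc)). Qed.

Let exTW b' : dual B' b' ->
  exists x : B', forall c', dual B' c' -> c' x = dcov P (T \o W) c' b'.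
Proof.
move=> db; exists (T (pettis P W (b' \o T))) => c' dc.
exact: (dual_pettis intW exW (dT db) (dT dc)).
Qed.

Lemma pettis_comp b' : dual B' b' -> pettis P (T \o W) b' = T (pettis P W (b' \o T)).
Proof.
move=> db; apply: (pettis_unique intTW exTW db) => c' dc.
exact: (dual_pettis intW exW (dT db) (dT dc)).
Qed.

(** Continuity of the embedding of the RKHS in [B]: a norming functional [f] turns the norm into the
    covariance of [f] and [b], to which Cauchy-Schwarz and the uniform second-moment bound apply. *)
Lemma norm_pettis_le : exists2 K : R, 0 < K & forall b, dual B b ->
  `|pettis P W b| <= K * dual_norm2 P W b.
Proof.
have [C C0 hC] := second_moment_le gW.
exists (Num.sqrt (C + 1)) => [|b db]; first by rewrite sqrtr_gt0 ltr_wpDl.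
have [f df [fle <-]] := norming_functional (pettis P W b).
have fle1 y : `|f y| <= 1 * `|y| by rewrite mul1r.
rewrite (dual_pettis intW exW db df) -sqrtrM ?addr_ge0//.
apply: le_trans (ler_norm _) _; rewrite -sqrtr_sqr ler_wsqrtr//.
apply: le_trans (dcov_CauchySchwarz intW df db) _.
apply: ler_wpM2r; first exact: dcov_ge0.
have := hC _ _ df ler01 fle1; rewrite expr1n mulr1 => h.
apply: (@le_trans _ _ C); last by rewrite lerDl.
by rewrite -lee_fin fineK//; exact: (integrable_fin_num measurableT (intW df df)).
Qed.

Let u (b : {linear B -> R^o}) (b' : {linear B' -> R^o}) := lincomb (-1) (b' \o T) b.

(** The residual of projecting [b] on the closure of the functionals [b' \o T] is handled through a
    minimizing sequence, without forming a completion. *)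
Lemma pullback_dense b e : dual B b -> 0 < e ->
  exists2 b', dual B' b' & dual_norm2 P W (lincomb (-1) (b' \o T) b) < e.
Proof.
move=> db e0; pose Q b' := dcov P W (u b b') (u b b').
have du b' : dual B' b' -> dual B (u b b') by move=> db'; apply: dual_lincomb => //; exact: dT.
pose S := [set Q b' | b' in dual B'].
have S0 : S !=set0 by exists (Q \0); exists \0 => //; exact: dual0.
have lS : lbound S 0 by move=> _ [b' _ <-]; exact: dcov_ge0.
have hlS : has_lbound S by exists 0.
pose M := inf S.
have MQ b' : dual B' b' -> M <= Q b' by move=> db'; apply: (ge_inf hlS); exists b'.
suff M0 : M <= 0.
  have [_ [b' db' <-] Qb'] := @inf_adherent _ S (e ^+ 2) (exprn_gt0 _ e0) (conj S0 hlS).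
  exists b' => //; rewrite /dual_norm2 -(ger0_norm (ltW e0)) -sqrtr_sqr.
  rewrite ltr_sqrt ?exprn_gt0//; apply: lt_le_trans Qb' _.
  by rewrite gerDr.
have /choice[a ha] : forall n : nat, exists b', dual B' b' /\ Q b' < M + n.+1%:R^-1.
  move=> n; have n0 : 0 < n.+1%:R^-1 :> R by rewrite invr_gt0.
  by have [_ [b' db' <-] Qb'] := inf_adherent n0 (conj S0 hlS); exists b'.
have da n := (ha n).1; have Qa n := (ha n).2.
pose c n := u b (a n); have dc n : dual B (c n) by exact: du.
have cc m n : dcov P W (lincomb (-1) (c n) (c m)) (lincomb (-1) (c n) (c m)) <=
    2 * (m.+1%:R^-1 + n.+1%:R^-1).
  (* The midpoint of [a m] and [a n]: by the parallelogram identity the left side is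
     [2 Q (a m) + 2 Q (a n) - 4 Q mid], and [Q mid >= M]. *)
  pose mid := lincomb 2^-1 (lincomb (-1) (a m) (a n)) (a m).
  have dmid : dual B' mid by do 2 apply: dual_lincomb => //.
  pose x : {linear B -> R^o} := a m \o T; pose y : {linear B -> R^o} := a n \o T.
  have dx : dual B x by exact: dT.
  have dy : dual B y by exact: dT.
  have dyx : dual B (lincomb (-1) x y) by exact: dual_lincomb.
  have Qmid : Q mid = dcov P W b b - dcov P W x b - dcov P W y b +
      (dcov P W x x + 2 * dcov P W x y + dcov P W y y) / 4.
    have -> : Q mid = dcov P W (lincomb (-1) (lincomb 2^-1 (lincomb (-1) x y) x) b)
      (lincomb (-1) (lincomb 2^-1 (lincomb (-1) x y) x) b) by [].
    rewrite (dcov_lincomb intW (-1) (dual_lincomb dyx dx) db).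
    rewrite (dcov_lincomb intW _ dyx dx) (dcov_lincomb intW _ dx dy).
    rewrite !(dcov_lincombl intW)// (dcovC P W y x); by field.
  have Qm : Q (a m) = dcov P W b b - 2 * dcov P W x b + dcov P W x x.
    by rewrite /Q (dcov_lincomb intW (-1) dx db); ring.
  have Qn : Q (a n) = dcov P W b b - 2 * dcov P W y b + dcov P W y y.
    by rewrite /Q (dcov_lincomb intW (-1) dy db); ring.
  rewrite [leLHS](_ : _ = 2 * Q (a m) + 2 * Q (a n) - 4 * Q mid).
    have := MQ _ dmid; have := Qa m; have := Qa n.
    move: (m.+1%:R^-1) (n.+1%:R^-1) => p q; lra.
    rewrite (dcov_lincomb intW (-1) (dc n) (dc m)) Qmid.
    have -> : dcov P W (c n) (c m) =
        dcov P W b b - dcov P W x b - dcov P W y b + dcov P W x y.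
      rewrite (dcov_lincombl intW (-1) dy db (dc m)).
      rewrite (dcov_lincombr intW (-1) dx db dy) (dcov_lincombr intW (-1) dx db db).
      by rewrite (dcovC P W y x) (dcovC P W b x); ring.
    rewrite -/(Q (a m)) -/(Q (a n)) Qm Qn; by field.
have orth n b' : dual B' b' ->
    dcov P W (b' \o T) (c n) ^+ 2 <= dcov P W (b' \o T) (b' \o T) * n.+1%:R^-1.
  move=> db'; rewrite mulrC; apply: discriminant_le => [|t]; first exact: dcov_ge0.
  (* Moving from [a n] to [a n + t b'] cannot bring [Q] below [M], while [Q (a n)] exceeds [M] by
     less than [1 / (n + 1)]; the discriminant of the resulting quadratic in [t] gives the bound. *)
  have dat : dual B' (lincomb t b' (a n)) by exact: dual_lincomb.
  have := MQ _ dat; have := Qa n.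
  have -> : Q (lincomb t b' (a n)) =
      dcov P W (lincomb (- t) (b' \o T) (c n)) (lincomb (- t) (b' \o T) (c n)).
    have E y : u b (lincomb t b' (a n)) y = lincomb (- t) (b' \o T) (c n) y.
      have -> : u b (lincomb t b' (a n)) y = -1 * (t * b' (T y) + a n (T y)) + b y.
        by [].
      have -> : lincomb (- t) (b' \o T) (c n) y =
        - t * b' (T y) + (-1 * a n (T y) + b y) by [].
      by ring.
    by apply: eq_Rintegral => w _; rewrite !E.
  rewrite (dcov_lincomb intW _ (dT db') (dc n)) -/(Q (a n)).
  move: (n.+1%:R^-1) => q; lra.
have [K K0 hK] := norm_pettis_le.
have cg : cvg (pettis P W (c n) @[n --> \oo]).
  apply: cauchy_seq_cvg => r r0.
  (* Two reciprocals below this value make the bound in [cc] less than [(r / K) ^+ 2]. *)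
  have rK : 0 < (r / K) ^+ 2 / 4 by rewrite divr_gt0 ?exprn_gt0 ?divr_gt0.
  have [N hN] := invSn_lt rK.
  exists N => m n Nm Nn; rewrite (pettisB intW exW)//.
  apply: le_lt_trans (hK _ (dual_lincomb (dc n) (dc m))) _.
  rewrite mulrC -ltr_pdivlMr//.
  rewrite /dual_norm2 -(ger0_norm (ltW (divr_gt0 r0 K0))) -sqrtr_sqr.
  rewrite ltr_sqrt ?exprn_gt0 ?divr_gt0//; apply: le_lt_trans (cc m n) _.
  have := hN _ Nm; have := hN _ Nn.
  move: (m.+1%:R^-1) (n.+1%:R^-1) => p q; lra.
set g := lim (pettis P W (c n) @[n --> \oo]) in cg.
have clim e1 : dual B e1 -> dcov P W e1 (c n) @[n --> \oo] --> e1 g.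
  move=> de; rewrite (_ : (fun n => _) = e1 \o (fun n => pettis P W (c n))).
    by apply: cvg_comp; [exact: cg|exact: de].
  by apply/funext => n /=; rewrite (dual_pettis intW exW).
have Tg : T g = 0.
  apply: dual_separates => b' db'; rewrite linear0.
  have d' := dT db'; have := clim _ d'; set q := dcov P W (b' \o T) (b' \o T).
  move=> h; apply: (norm_cvg_unique h).
  apply/cvgrPdist_lt => r r0.
  have q1 : 0 < q + 1 by rewrite ltr_wpDl// dcov_ge0.
  have [N hN] := invSn_lt (divr_gt0 (exprn_gt0 2 r0) q1).
  exists N => // n /= /hN nN; rewrite sub0r normrN -(ger0_norm (ltW r0)).
  rewrite -ltr_sqr ?nnegrE// !real_normK ?num_real//.
  apply: le_lt_trans (orth n _ db') _; rewrite -/q.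
  have nn : 0 < n.+1%:R^-1 :> R by rewrite invr_gt0.
  move: nN; rewrite ltr_pdivlMr// => /(le_lt_trans _); apply.
  by rewrite mulrC ler_pM2l// lerDl.
have g0 : g = 0 by apply: injT; rewrite Tg linear0.
rewrite leNgt; apply/negP => M0.
(* Fix [m], then take [n] large: the covariance of [c m] and [c n] drops below [M / 4], so the
   variance of their difference exceeds [2 M - M / 2], whereas [cc] makes it less than [M]. *)
have M4 : 0 < M / 4 by rewrite divr_gt0.
have [m hm] := invSn_lt M4.
have := clim _ (dc m); rewrite g0 linear0 => /cvgrPdist_lt/(_ _ M4)[k _ hk].
pose n := maxn m k.
have := hk n (leq_maxr _ _); rewrite sub0r normrN => /(le_lt_trans (ler_norm _)).
have := hm _ (leqnn m); have := hm n (leq_maxl _ _).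
have := cc m n; rewrite (dcov_lincomb intW)// (dcovC _ _ (c n)).
have := MQ _ (da m); have := MQ _ (da n); rewrite /Q -/(c m) -/(c n).
move: (m.+1%:R^-1) (n.+1%:R^-1) => p q; lra.
Qed.

Lemma pettis_norm_compB (f g : {linear B' -> R^o}) : dual B' f -> dual B' g ->
  pettis_norm P (T \o W) (pettis P (T \o W) f - pettis P (T \o W) g) =
  pettis_norm P W (pettis P W (f \o T) - pettis P W (g \o T)).
Proof.
move=> df dg; rewrite (pettis_normBE intTW exTW df dg).
by rewrite (pettis_normBE intW exW (dT df) (dT dg)).
Qed.

Lemma pettis_norm_comp (f : {linear B' -> R^o}) : dual B' f ->
  pettis_norm P (T \o W) (pettis P (T \o W) f) =
  pettis_norm P W (pettis P W (f \o T)).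
Proof.
by move=> df; rewrite (pettis_normE intTW exTW df) (pettis_normE intW exW (dT df)).
Qed.

(** Each [hs n] comes from a functional on [B']; composing with [T] preserves the norms of terms and
    differences. The pulled-back sequence is thus Cauchy in [B] as well, and continuity of [T]
    identifies its limit. *)
Lemma rkhs_approx_pull hs x' : rkhs_approx P (T \o W) hs x' ->
  exists gs x, [/\ rkhs_approx P W gs x, T x = x' &
    forall n, pettis_norm P W (gs n) = pettis_norm P (T \o W) (hs n)].
Proof.
move=> [hsR hsC hsx].
have /choice[f hf] : forall n, exists f : {linear B' -> R^o},
    dual B' f /\ pettis P (T \o W) f = hs n.
  by move=> n; have [f df fE] := hsR n; exists f.
have df n := (hf n).1; have fE n := (hf n).2.
pose gs n := pettis P W (f n \o T).
have hsE n : hs n = T (gs n) by rewrite -fE pettis_comp.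
have gsC e : 0 < e -> exists N : nat, forall m n : nat,
    (N <= m)%N -> (N <= n)%N -> pettis_norm P W (gs m - gs n) < e.
  move=> /hsC[N hN]; exists N => m n Nm Nn.
  by rewrite -pettis_norm_compB// !fE; exact: hN.
have [K K0 hK] := norm_pettis_le.
have gsB m n : `|gs m - gs n| <= K * pettis_norm P W (gs m - gs n).
  rewrite (pettis_normBE intW exW (dT (df m)) (dT (df n))).
  rewrite (pettisB intW exW (dT (df m)) (dT (df n))).
  by apply: hK; exact: (dual_lincomb (dT (df n)) (dT (df m))).
have /cvg_ex[l gsl] : cvg (gs n @[n --> \oo]).
  apply: cauchy_seq_cvg => e e0; have [N hN] := gsC _ (divr_gt0 e0 K0).
  exists N => m n Nm Nn; apply: le_lt_trans (gsB m n) _.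
  by rewrite mulrC -ltr_pdivlMr//; exact: hN.
exists gs, l; split => //.
- by split => // n; exists (f n \o T) => //; exact: dT.
- have Tgs : hs n @[n --> \oo] --> T l.
    rewrite (_ : hs = T \o gs); last exact/funext.
    by apply: (@cvg_comp _ _ _ gs T _ _ _ gsl); exact: cT.
  exact: norm_cvg_unique Tgs hsx.
- by move=> n; rewrite -fE pettis_norm_comp.
Qed.

(** The functional behind [hs n] need not factor through [T], so it is replaced by some [f n \o T]
    within [1 / (n + 1)] in the covariance seminorm; limit and asymptotic norms do not change. *)
Lemma rkhs_approx_push hs x : rkhs_approx P W hs x ->
  exists2 hs', rkhs_approx P (T \o W) hs' (T x) &
    pettis_norm P (T \o W) (hs' n) - pettis_norm P W (hs n) @[n --> \oo] --> 0.
Proof.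
move=> [hsR hsC hsx].
have /choice[b hb] : forall n, exists b : {linear B -> R^o},
    dual B b /\ pettis P W b = hs n.
  by move=> n; have [b db bE] := hsR n; exists b.
have db n := (hb n).1; have bE n := (hb n).2.
have /choice[f hf] : forall n, exists f : {linear B' -> R^o}, dual B' f /\
    dual_norm2 P W (lincomb (-1) (f \o T) (b n)) < n.+1%:R^-1.
  move=> n; have n0 : 0 < n.+1%:R^-1 :> R by rewrite invr_gt0.
  by have [f df fb] := pullback_dense (db n) n0; exists f.
have df n := (hf n).1; have fb n := (hf n).2.
pose nrm := pettis_norm P W.
pose gs n := pettis P W (f n \o T).
have gE n : gs n = hs n - pettis P W (lincomb (-1) (f n \o T) (b n)).
  by rewrite -(pettisB intW exW (db n) (dT (df n))) bE opprB addrC subrK.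
pose hs' n := pettis P (T \o W) (f n).
have hsE n : hs' n = T (gs n) by exact: pettis_comp.
have norm_diff n : `|pettis_norm P (T \o W) (hs' n) - nrm (hs n)| < n.+1%:R^-1.
  apply: le_lt_trans (fb n).
  rewrite pettis_norm_comp// /nrm -bE.
  rewrite (pettis_normE intW exW (dT (df n))) (pettis_normE intW exW (db n)).
  exact: (dual_norm2_dist intW (dT (df n)) (db n)).
have [K K0 hK] := norm_pettis_le.
exists hs'; last first.
  apply/cvgrPdist_lt => e e0; have [N hN] := invSn_lt e0.
  exists N => // n /= /hN; apply: lt_trans; rewrite sub0r normrN; exact: norm_diff.
split.
- by move=> n; exists (f n).
- move=> e e0; have e3 : 0 < e / 3 by rewrite divr_gt0.
  have [N1 hN1] := hsC _ e3; have [N2 hN2] := invSn_lt e3.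
  exists (maxn N1 N2) => m n; rewrite !geq_max => /andP[Nm1 Nm2] /andP[Nn1 Nn2].
  rewrite pettis_norm_compB// (pettis_normBE intW exW (dT (df m)) (dT (df n))).
  have h1 := hN1 _ _ Nm1 Nn1.
  rewrite -!bE (pettis_normBE intW exW (db m) (db n)) in h1.
  have h2 := lt_trans (fb m) (hN2 _ Nm2); have h3 := lt_trans (fb n) (hN2 _ Nn2).
  have := dual_norm2_triangle3 intW (dT (df m)) (db m) (db n) (dT (df n)); lra.
rewrite (_ : hs' = T \o gs); last exact/funext.
suff gsx : gs n @[n --> \oo] --> x.
  by apply: (@cvg_comp _ _ _ gs T _ _ _ gsx); exact: cT.
(* The correction is a Pettis integral of vanishing seminorm, so it tends to 0 in [B]. *)
rewrite (_ : gs = fun n => hs n - pettis P W (lincomb (-1) (f n \o T) (b n)));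
  last exact/funext.
rewrite -[x]subr0; apply: cvgB => //.
apply/cvgrPdist_lt => e e0; have [N hN] := invSn_lt (divr_gt0 e0 K0).
exists N => // n /= /hN Nn; rewrite sub0r normrN.
apply: le_lt_trans (hK _ (dual_lincomb (dT (df n)) (db n))) _.
by rewrite mulrC -ltr_pdivlMr//; exact: lt_trans (fb n) Nn.
Qed.

Lemma zero_mean_gaussian_comp : zero_mean_gaussian P (T \o W).
Proof.
split; last by move=> f df; exact: (gW.2 _ (dT df)).
apply: (@measurability _ _ Omega (g_sigma_algebraType (@open B')) _ _ (@open B')) => //.
move=> _ [U oU <-]; rewrite setTI comp_preimage.
apply: (measurable_preimage_open gW); apply: open_comp => // x _; exact: cT.
Qed.

End image.

Theorem lemma7p1 (R : realType) (d : measure_display)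
    (Omega : measurableType d) (P : probability Omega R)
    (B B' : completeNormedModType R) (T : {linear B -> B'}) (W : Omega -> B) :
  separable B ->
  injective T ->
  continuous T ->
  zero_mean_gaussian P W ->
  [/\ zero_mean_gaussian P (T \o W),
      rkhs P (T \o W) = T @` rkhs P W &
      forall h : B, rkhs P W h ->
        rkhs_norm P (T \o W) (T h) = rkhs_norm P W h].
Proof.
move=> sepB injT cT gW; split; first exact: zero_mean_gaussian_comp.
- apply/seteqP; split => [x' [hs hsx]|_ [x [hs hsx] <-]].
    have [gs [x [gsx <- _]]] := rkhs_approx_pull sepB cT gW hsx.
    by exists x => //; exists gs.
  by have [hs' hs'x _] := rkhs_approx_push sepB injT cT gW hsx; exists hs'.
(* Both norms are [get] of a set of limits, so they agree once the two sets do. *)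
move=> h _; rewrite /rkhs_norm; congr get; apply/seteqP; split => r /= [hs hsx hsr].
  have [gs [x [gsx /injT xh gsE]]] := rkhs_approx_pull sepB cT gW hsx.
  exists gs; first by rewrite -xh.
  by rewrite (_ : (fun n => _) = fun n => pettis_norm P (T \o W) (hs n))//; apply/funext.
have [hs' hs'x d0] := rkhs_approx_push sepB injT cT gW hsx.
exists hs' => //; rewrite -[r]add0r.
rewrite (_ : (fun n => _) = fun n => pettis_norm P (T \o W) (hs' n) -
  pettis_norm P W (hs n) + pettis_norm P W (hs n)); first exact: cvgD.
by apply/funext => n; rewrite subrK.
Qed.
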